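(* Let $x_{k+1}=f(x_k,u_k)$ be a discrete-time control system with $f:\mathcal{X}\times\mathcal{U}\to\mathcal{X}$, and let $\Phi=\bigwedge_{i=1}^N\Phi_i^{[a_i,b_i]}$ be an STL formula of the form described in the context, with terminal instant $T=\max_i b_i$. Suppose that the online monitoring algorithm described in the context is run with the exact $I$-remaining feasible sets $X_k^I$ (as defined in the context). Then the algorithm is sound and complete: for every $k\in\{0,\dots,T\}$ and every prefix signal $\mathbf{x}_{0:k}=x_0x_1\cdots x_k$ generated by the system (i.e. $x_0\in\mathcal{X}$ and, for each $0\le j<k$, $x_{j+1}=f(x_j,u_j)$ for some $u_j\in\mathcal{U}$), the decision $\mathcal{M}(\mathbf{x}_{0:k})\in\{0,1\}$ produced by the algorithm satisfies $$\mathcal{M}(\mathbf{x}_{0:k})=1\iff \mathbf{x}_{0:k}\text{ is a violated prefix, i.e. } \mathbf{x}_{0:k}\,\xi_f(x_k,\mathbf{u}_{k:T-1})\not\models\Phi \text{ for all } \mathbf{u}_{k:T-1}\in\mathcal{U}^{T-k}.$$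
   Context: **System.** $\mathcal{X}\subset\mathbb{R}^n$ and $\mathcal{U}\subset\mathbb{R}^m$ are bounded, and $f:\mathcal{X}\times\mathcal{U}\to\mathcal{X}$ is continuous. For $x_k\in\mathcal{X}$ and $\mathbf{u}_{k:T-1}=u_k\cdots u_{T-1}\in\mathcal{U}^{T-k}$, $\xi_f(x_k,\mathbf{u}_{k:T-1})=x_{k+1}\cdots x_T$ denotes the state sequence with $x_{j+1}=f(x_j,u_j)$ for $j=k,\dots,T-1$ (the empty sequence if $k=T$). Juxtaposition of sequences is concatenation. **Formulae.** Intervals $[a,b]$ are integer intervals with $0\le a\le b$. $\Phi=\bigwedge_{i=1}^N\Phi_i^{[a_i,b_i]}$ with $a_1\le\cdots\le a_N$, where each $\Phi_i^{[a_i,b_i]}$ is of one of the following forms (with $\mathcal{H}_i,\mathcal{H}_i^1,\mathcal{H}_i^2\subseteq\mathcal{X}$), interpreted on a state sequence at absolute time instants: - $\mathbf{G}_{[a_i,b_i]}\,x\in\mathcal{H}_i$: $x_j\in\mathcal{H}_i$ for all $j\in[a_i,b_i]$; - $x\in\mathcal{H}_i^1\,\mathbf{U}'_{[a_i,b_i]}\,x\in\mathcal{H}_i^2$: there is $k'\in[a_i,b_i]$ with $x_{k'}\in\mathcal{H}_i^2$ and $x_{k''}\in\mathcal{H}_i^1$ for all $k''\in[a_i,k']$; - $\mathbf{F}_{[a_i,b_i]}\,x\in\mathcal{H}_i$: $x_j\in\mathcal{H}_i$ for some $j\in[a_i,b_i]$; this is always treated as the $\mathbf{U}'$ formula $x\in\mathcal{X}\,\mathbf{U}'_{[a_i,b_i]}\,x\in\mathcal{H}_i$.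 Hence each sub-formula has operator $O_i\in\{\mathbf{G},\mathbf{U}'\}$. A sequence satisfies ($\models$) a conjunction iff it satisfies every conjunct. Let $\mathcal{I}=\{1,\dots,N\}$, $\mathcal{I}_k=\{i\in\mathcal{I}: a_i\le k\le b_i\}$, $\mathcal{I}_{>k}=\{i\in\mathcal{I}: k<a_i\}$. **Remaining formula and feasible set.** For $I\subseteq\mathcal{I}$ and $k\in[0,T]$, the $I$-remaining formula is $$\hat\Phi_k^I=\bigwedge_{i\in I\cap\mathcal{I}_k}\Phi_i^{[k,b_i]}\wedge\bigwedge_{i\in I\cap\mathcal{I}_{>k}}\Phi_i^{[a_i,b_i]},$$ where $\Phi_i^{[k,b_i]}$ is $\Phi_i^{[a_i,b_i]}$ with the start instant $a_i$ of the temporal operator replaced by $k$. The $I$-remaining feasible set is $$X_k^I=\{x_k\in\mathcal{X}:\exists\,\mathbf{u}_{k:T-1}\in\mathcal{U}^{T-k}\text{ with } x_k\,\xi_f(x_k,\mathbf{u}_{k:T-1})\models\hat\Phi_k^I\},$$ where the sequence $x_k\,\xi_f(x_k,\mathbf{u}_{k:T-1})=x_kx_{k+1}\cdots x_T$ is indexed by the absolute instants $k,\dots,T$. **Online monitoring algorithm.** Initialize $k\leftarrow 0$, $I\leftarrow\mathcal{I}$. While $I\ne\emptyset$: read the current state $x_k$. If $x_k\notin X_k^I$, set $\mathcal{M}_k=1$ and terminate returning ''prefix is violated''. Otherwise set $\mathcal{M}_k=0$, and for every $i\in I\cap\mathcal{I}_k$ remove $i$ from $I$ if either ($O_i=\mathbf{G}$,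 $k=b_i$ and $x_k\in\mathcal{H}_i$) or ($O_i=\mathbf{U}'$ and $x_k\in\mathcal{H}_i^1\cap\mathcal{H}_i^2$); then $k\leftarrow k+1$. When $I=\emptyset$, terminate returning ''$\Phi$ has been satisfied''. The decision $\mathcal{M}(\mathbf{x}_{0:k})$ is the value $\mathcal{M}_k$ obtained when the algorithm is fed the states $x_0,x_1,\dots,x_k$; if the algorithm has already terminated at an instant before $k$, then $\mathcal{M}(\mathbf{x}_{0:k})=1$ if it returned ''prefix is violated'' and $\mathcal{M}(\mathbf{x}_{0:k})=0$ if it returned ''$\Phi$ has been satisfied''. *)

(* Defs.v *)
From HB Require Import structures.
From mathcomp Require Import all_boot all_order all_algebra.
From mathcomp Require Import all_classical all_reals all_analysis.

Set Implicit Arguments.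
Unset Strict Implicit.
Unset Printing Implicit Defensive.

Import Order.TTheory GRing.Theory Num.Theory.
Import numFieldNormedType.Exports.

Local Open Scope classical_set_scope.
Local Open Scope ring_scope.

Inductive operator (S : Type) : Type :=
  | Always of set S
  | Until of set S & set S
  | Eventually of set S.

(* The sub-formula [op] over the integer interval [[start, stop]]. *)
Record subformula (S : Type) : Type :=
  Subformula { start : nat; stop : nat; op : operator S }.

Definition regions_in (S : Type) (X : set S) (o : operator S) : Prop :=
  match o with
  | Always H => H `<=` X
  | Until H1 H2 => H1 `<=` X /\ H2 `<=` X
  | Eventually H => H `<=` X
  end.

(* [s] is a state sequence whose head is the state at the absolute instant
   [k0]. The default value of [nth] is never reached when
   [k0 <= start <= stop < k0 + size s], which holds for the formulas
   below at instants up to [horizon]. *)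
Definition state_at (R : realType) (n : nat) (k0 : nat) (s : seq 'rV[R]_n)
    (j : nat) : 'rV[R]_n :=
  nth 0 s (j - k0)%N.

Definition sat (R : realType) (n : nat) (k0 : nat) (s : seq 'rV[R]_n)
    (psi : subformula 'rV[R]_n) : Prop :=
  let: Subformula a b o := psi in
  match o with
  | Always H =>
      forall j, (a <= j <= b)%N -> H (state_at k0 s j)
  | Until H1 H2 =>
      exists k', [/\ (a <= k' <= b)%N, H2 (state_at k0 s k') &
        forall k'', (a <= k'' <= k')%N -> H1 (state_at k0 s k'')]
  | Eventually H =>
      exists2 j, (a <= j <= b)%N & H (state_at k0 s j)
  end.

(* A conjunction is represented by the set of its conjuncts. *)
Definition models (R : realType) (n : nat) (k0 : nat) (s : seq 'rV[R]_n)
    (Psi : set (subformula 'rV[R]_n)) : Prop :=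
  forall psi, Psi psi -> sat k0 s psi.

Definition horizon (S : Type) (N : nat) (Phi : 'I_N -> subformula S) : nat :=
  (\max_(i < N) stop (Phi i))%N.

(* [trajectory f x [:: u_k; ...; u_(T-1)]] is [:: x_(k+1); ...; x_T]: the
   initial state [x] is not included. *)
Definition trajectory (R : realType) (n m : nat)
    (f : 'rV[R]_n -> 'rV[R]_m -> 'rV[R]_n) (x : 'rV[R]_n)
    (us : seq 'rV[R]_m) : seq 'rV[R]_n :=
  scanl f x us.

Definition inputs (S : Type) (U : set S) (d : nat) : set (d.-tuple S) :=
  [set us : d.-tuple S | forall j, U (tnth us j)].

Definition active (S : Type) (N : nat) (Phi : 'I_N -> subformula S) (k : nat) :
    {set 'I_N} :=
  finset (fun i => start (Phi i) <= k <= stop (Phi i))%N.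

Definition future (S : Type) (N : nat) (Phi : 'I_N -> subformula S) (k : nat) :
    {set 'I_N} :=
  finset (fun i => k < start (Phi i))%N.

Definition restart (S : Type) (k : nat) (psi : subformula S) : subformula S :=
  Subformula k (stop psi) (op psi).

Definition remaining (S : Type) (N : nat) (Phi : 'I_N -> subformula S)
    (k : nat) (I : {set 'I_N}) : set (subformula S) :=
  [set restart k (Phi i) | i in [set` I :&: active Phi k]] `|`
  [set Phi i | i in [set` I :&: future Phi k]].

Definition feasible (R : realType) (n m N : nat)
    (X : set 'rV[R]_n) (U : set 'rV[R]_m)
    (f : 'rV[R]_n -> 'rV[R]_m -> 'rV[R]_n)
    (Phi : 'I_N -> subformula 'rV[R]_n) (k : nat) (I : {set 'I_N}) :
    set 'rV[R]_n :=
  [set x | X x /\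
    exists2 us : (horizon Phi - k)%N.-tuple 'rV[R]_m, inputs U us &
      models k (x :: trajectory f x us) (remaining Phi k I)].

(* [Eventually H] is treated as [Until X H]. *)
Definition discharged (S : Type) (X : set S) (k : nat) (x : S)
    (psi : subformula S) : Prop :=
  match op psi with
  | Always H => k = stop psi /\ H x
  | Until H1 H2 => (H1 `&` H2) x
  | Eventually H => (X `&` H) x
  end.

Definition update (S : Type) (N : nat) (X : set S)
    (Phi : 'I_N -> subformula S) (k : nat) (x : S) (I : {set 'I_N}) :
    {set 'I_N} :=
  I :\: finset (fun i => (i \in I :&: active Phi k) &&
                         `[< discharged X k x (Phi i) >]).

(* [Running I]: all available states have been read, no termination yet. *)
Inductive status (N : nat) : Type :=
  | Running of {set 'I_N}
  | PrefixViolated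
  | FormulaSatisfied.

(* The while loop, entered at instant [k] with index set [I] and fed the
   states [xs] of the instants [k, k+1, ...]. *)
Fixpoint monitor_loop (R : realType) (n m N : nat)
    (X : set 'rV[R]_n) (U : set 'rV[R]_m)
    (f : 'rV[R]_n -> 'rV[R]_m -> 'rV[R]_n)
    (Phi : 'I_N -> subformula 'rV[R]_n) (k : nat) (I : {set 'I_N})
    (xs : seq 'rV[R]_n) : status N :=
  if I == finset.set0 then FormulaSatisfied N
  else match xs with
  | [::] => Running I
  | x :: xs' =>
      if `[< feasible X U f Phi k I x >]
      then monitor_loop X U f Phi k.+1 (update X Phi k x I) xs'
      else PrefixViolated N
  end.

(* [true] encodes the decision 1 and [false] the decision 0. A loop still
   running has passed the feasibility test at the last state read. *)
Definition monitor (R : realType) (n m N : nat)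
    (X : set 'rV[R]_n) (U : set 'rV[R]_m)
    (f : 'rV[R]_n -> 'rV[R]_m -> 'rV[R]_n)
    (Phi : 'I_N -> subformula 'rV[R]_n) (xs : seq 'rV[R]_n) : bool :=
  match monitor_loop X U f Phi 0 (finset.setTfor 'I_N) xs with
  | PrefixViolated => true
  | Running _ | FormulaSatisfied => false
  end.

Definition generated (R : realType) (n m : nat)
    (X : set 'rV[R]_n) (U : set 'rV[R]_m)
    (f : 'rV[R]_n -> 'rV[R]_m -> 'rV[R]_n) (k : nat)
    (xs : k.+1.-tuple 'rV[R]_n) : Prop :=
  X (nth 0 xs 0) /\
  forall j, (j < k)%N -> exists2 u, U u & nth 0 xs j.+1 = f (nth 0 xs j) u.

Definition violated_prefix (R : realType) (n m N : nat) (U : set 'rV[R]_m)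
    (f : 'rV[R]_n -> 'rV[R]_m -> 'rV[R]_n)
    (Phi : 'I_N -> subformula 'rV[R]_n) (k : nat)
    (xs : k.+1.-tuple 'rV[R]_n) : Prop :=
  forall us : (horizon Phi - k)%N.-tuple 'rV[R]_m, inputs U us ->
    ~ models 0 (xs ++ trajectory f (nth 0 xs k) us) (range Phi).

(* Main.v *)
(** Reading one more state turns the remaining formula at instant [k] into the
    one at instant [k + 1]: a conjunct active at [k] either is discharged by
    [x_k], or constrains [x_k] and restarts at [k + 1].  Feasibility of [x_k]
    guarantees the constraint on [x_k] and that no undischarged conjunct
    expires at [k], so an extension satisfies the formula remaining at [k] iff
    its tail satisfies the formula remaining at [k + 1].  The only other
    possible failure is a prefix without any admissible input sequence
    ([U] empty), which the feasibility test at the first instant excludes. *)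
Require Import Defs.
From HB Require Import structures.
From mathcomp Require Import all_boot all_order all_algebra.
From mathcomp Require Import all_classical all_reals all_analysis.
From mathcomp Require Import zify.

Set Implicit Arguments.
Unset Strict Implicit.
Unset Printing Implicit Defensive.

Import Order.TTheory GRing.Theory Num.Theory.
Import numFieldNormedType.Exports.

Local Open Scope classical_set_scope.
Local Open Scope ring_scope.

(** * Admissible state sequences as paths of the transition relation *)

Definition step (S A : Type) (U : set A) (f : S -> A -> S) : rel S :=
  fun x y => `[< exists2 u, U u & y = f x u >].

(** This eliminates the inputs: admissibility becomes a property of the states alone, so that
    extending a prefix is concatenation of paths. *)
Lemma path_trajectory (R : realType) (n m : nat) (U : set 'rV[R]_m)
    (f : 'rV[R]_n -> 'rV[R]_m -> 'rV[R]_n) (d : nat) (x : 'rV[R]_n)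
    (t : seq 'rV[R]_n) :
  (size t = d /\ path (step U f) x t) <->
  exists2 us : d.-tuple 'rV[R]_m, inputs U us & t = trajectory f x us.
Proof.
elim: d x t => [|d IHd] x t.
  split=> [[/size0nil-> _]|[us _ ->]]; last by rewrite tuple0.
  by exists [tuple]; first by case.
split=> [|[us Uus ->]].
  case: t => [|y t] [] //= [st] /andP[/asboolP[u Uu yE] pt].
  have [us Uus tE] := (IHd y t).1 (conj st pt).
  exists [tuple of u :: us]; last by rewrite /= -yE tE.
  (* Arguing by membership replaces a case analysis on the index [j]: an entry is [u] or an entry of
     [us]. *)
  move=> j; have := mem_tnth j [tuple of u :: us].
  rewrite in_cons => /orP[/eqP->//|/tnthP[i ->]]; exact: Uus.
case: (tupleP us) Uus => u vs Uvs.
have [st pt] : size (trajectory f (f x u) vs) = d /\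
    path (step U f) (f x u) (trajectory f (f x u) vs).
  by apply/IHd; exists vs => // j; have := Uvs (lift ord0 j); rewrite tnthS.
split; first by rewrite /= -[in RHS]st.
rewrite /= pt andbT; apply/asboolP; exists u => //.
by have := Uvs ord0; rewrite tnth0.
Qed.

(** One fixed admissible input, applied at every instant, yields a path of any length. *)
Lemma path_total (S A : Type) (U : set A) (f : S -> A -> S) (x : S) (d : nat) :
  U !=set0 -> exists2 t, size t = d & path (step U f) x t.
Proof.
move=> [u Uu]; elim: d x => [|d IHd] x; first by exists [::].
have [t st pt] := IHd (f x u); exists (f x u :: t); first by rewrite /= st.
by rewrite /= pt andbT; apply/asboolP; exists u.
Qed.

Lemma generated_path (R : realType) (n m : nat)
    (X : set 'rV[R]_n) (U : set 'rV[R]_m)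
    (f : 'rV[R]_n -> 'rV[R]_m -> 'rV[R]_n) (k : nat) (x : 'rV[R]_n)
    (xs : k.-tuple 'rV[R]_n) :
  generated X U f [tuple of x :: xs] -> X x /\ path (step U f) x xs.
Proof.
move=> [Xx gen]; split=> //; apply/(pathP 0) => i.
by rewrite size_tuple => /gen ?; apply/asboolP.
Qed.

(** * One-step unfolding of the temporal operators *)

Section Sat.
Variables (R : realType) (n : nat).
Implicit Types (x : 'rV[R]_n) (s : seq 'rV[R]_n) (o : operator 'rV[R]_n).

Lemma state_at_cons (k j : nat) x s : (k < j)%N ->
  state_at k (x :: s) j = state_at k.+1 s j.
Proof. by move=> kj; rewrite /state_at -(subnSK kj). Qed.

Lemma state_at_head (k : nat) x s : state_at k (x :: s) k = x.
Proof. by rewrite /state_at subnn. Qed.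

Lemma sat_future (k a b : nat) x s o : (k < a)%N ->
  sat k (x :: s) (Subformula a b o) <-> sat k.+1 s (Subformula a b o).
Proof.
move=> ka; have E j : (a <= j)%N -> state_at k (x :: s) j = state_at k.+1 s j.
  by move=> aj; apply: state_at_cons; apply: leq_trans ka aj.
case: o => [H|H1 H2|H] /=.
- by split=> h j jab; have := h j jab; rewrite E //; case/andP: jab.
- split=> -[k' [k'ab Hk' h]]; exists k'; split=> //.
  + by rewrite -E //; case/andP: k'ab.
  + by move=> j jk; rewrite -E; [exact: h|case/andP: jk].
  + by rewrite E //; case/andP: k'ab.
  + by move=> j jk; rewrite E; [exact: h|case/andP: jk].
- by split=> -[j jab Hj]; exists j => //; move: Hj; rewrite E //; case/andP: jab.
Qed.

(* The constraint that an undischarged active conjunct puts on the current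
   state. *)
Definition persists o x : Prop :=
  match o with
  | Always H => H x
  | Until H1 _ => H1 x
  | Eventually _ => True
  end.

(** For [Always] the cases are [k = b] and [k < b]; for the other operators they are a witness
    instant equal to [k] and a later one, which forces [k < b]. The premise [X x] serves
    [Eventually], whose discharge condition includes membership in [X]. *)
Lemma sat_unfold (X : set 'rV[R]_n) (k b : nat) x s o : X x -> (k <= b)%N ->
  sat k (x :: s) (Subformula k b o) <->
  discharged X k x (Subformula k b o) \/
  [/\ (k < b)%N, persists o x & sat k.+1 s (Subformula k.+1 b o)].
Proof.
move=> Xx kb; rewrite /discharged; case: o => [H|H1 H2|H] /=.
- split=> [h|[[-> Hx]|[ltkb Hx h]] j jkb].
  + have Hx : H x by have := h k; rewrite state_at_head; apply; rewrite leqnn.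
    have [->|neq] := eqVneq k b; [by left|right; split=> //; first lia].
    by move=> j jkb; rewrite -(state_at_cons x); [apply: h; lia|lia].
  + by have -> : j = b; [lia|rewrite state_at_head].
  + have [->|neq] := eqVneq j k; first by rewrite state_at_head.
    by rewrite state_at_cons; [apply: h; lia|lia].
- split=> [[k' [k'ab Hk' h]]|[[H1x H2x]|[ltkb Hx [k' [k'ab Hk' h]]]]].
  + have H1x : H1 x by have := h k; rewrite state_at_head; apply; lia.
    have [k'k|neq] := eqVneq k' k.
      by left; split=> //; move: Hk'; rewrite k'k state_at_head.
    right; split=> //; first lia.
    exists k'; split; [lia|by rewrite -(state_at_cons x) //; lia|].
    by move=> j jk; rewrite -(state_at_cons x); [apply: h; lia|lia].
  + exists k; rewrite state_at_head leqnn kb; split=> // j jk.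
    by have -> : j = k; [lia|rewrite state_at_head].
  + exists k'; split; [lia|by rewrite state_at_cons //; lia|move=> j jk].
    have [->|neq] := eqVneq j k; first by rewrite state_at_head.
    by rewrite state_at_cons; [apply: h; lia|lia].
- split=> [[j jkb Hj]|[[_ Hx]|[ltkb _ [j jkb Hj]]]].
  + have [jk|neq] := eqVneq j k.
      by left; split=> //; move: Hj; rewrite jk state_at_head.
    right; split=> //; first lia.
    by exists j; [lia|rewrite -(state_at_cons x) //; lia].
  + by exists k; [lia|rewrite state_at_head].
  + by exists j; [lia|rewrite state_at_cons //; lia].
Qed.

End Sat.

(** * The remaining formula and the monitoring loop *)

Section Monitor.
Variables (R : realType) (n m N : nat).
Variables (X : set 'rV[R]_n) (U : set 'rV[R]_m).
Variable f : 'rV[R]_n -> 'rV[R]_m -> 'rV[R]_n.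
Variable Phi : 'I_N -> subformula 'rV[R]_n.
Hypothesis f_stable : forall x u, X x -> U u -> X (f x u).

(** When nothing in [I] has expired, every index is active or future. The start
    [maxn k (start (Phi i))] covers both cases, since it leaves a future conjunct unchanged. *)
Lemma models_remaining (k : nat) (I : {set 'I_N}) (s : seq 'rV[R]_n) :
  (forall i, i \in I -> (k <= stop (Phi i))%N) ->
  models k s (remaining Phi k I) <->
  forall i, i \in I -> sat k s (restart (maxn k (start (Phi i))) (Phi i)).
Proof.
move=> Istop; split=> h.
  move=> i iI; have [ki|ik] := ltnP k (start (Phi i)).
    have -> : restart (start (Phi i)) (Phi i) = Phi i by case: (Phi i).
    apply: h; right; exists i => //=.
    by rewrite finset.in_setI iI finset.in_set.
  apply: h; left; exists i => //=.
  by rewrite finset.in_setI iI finset.in_set ik Istop.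
move=> psi [] [i /=]; rewrite finset.in_setI finset.in_set => /andP[iI].
  by move=> /andP[ik _] <-; have := h i iI; rewrite (maxn_idPl ik).
move=> ki <-; have := h i iI; rewrite (maxn_idPr (ltnW ki)).
by case: (Phi i).
Qed.

Lemma feasibleE (k : nat) (I : {set 'I_N}) (x : 'rV[R]_n) :
  feasible X U f Phi k I x <->
  X x /\ exists t, [/\ size t = (horizon Phi - k)%N, path (step U f) x t &
    models k (x :: t) (remaining Phi k I)].
Proof.
split=> -[Xx [t]].
  move=> Ut Mt; split=> //; exists (trajectory f x t).
  have [] := (path_trajectory U f _ x (trajectory f x t)).2
    (ex_intro2 _ _ t Ut erefl).
  by [].
move=> [st pt Mt]; split=> //.
have [us Uus tE] := (path_trajectory U f _ x t).1 (conj st pt).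
by exists us => //; rewrite -tE.
Qed.

Lemma in_update (k : nat) (x : 'rV[R]_n) (I : {set 'I_N}) (i : 'I_N) :
  (forall i, i \in I -> (k <= stop (Phi i))%N) ->
  (i \in update X Phi k x I) =
  (i \in I) && ~~ ((start (Phi i) <= k)%N && `[< discharged X k x (Phi i) >]).
Proof.
move=> Istop; rewrite finset.in_setD finset.in_set finset.in_setI finset.in_set.
by have [iI|] := boolP (i \in I); rewrite ?andbF //= (Istop i iI) !andbT.
Qed.

(** The extension witnessing feasibility satisfies each conjunct; unfolding an undischarged active
    one leaves only the second alternative of [sat_unfold]. This carries the invariant
    [k <= stop (Phi i)] over to [k.+1]. *)
Lemma feasible_stop (k : nat) (I : {set 'I_N}) (x : 'rV[R]_n) :
  (forall i, i \in I -> (k <= stop (Phi i))%N) ->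
  (forall i, start (Phi i) <= stop (Phi i))%N ->
  feasible X U f Phi k I x ->
  forall i, i \in update X Phi k x I ->
    (k < stop (Phi i))%N /\
    ((start (Phi i) <= k)%N -> persists (op (Phi i)) x).
Proof.
move=> Istop Phi_interval /feasibleE[Xx [t [_ _ /models_remaining h]]] i.
rewrite in_update // => /andP[iI].
have [ik|ki] := leqP (start (Phi i)) k; last first.
  by split=> //; apply: leq_trans ki (Phi_interval i).
move=> /asboolP ndis; have := h Istop i iI; rewrite (maxn_idPl ik) /restart.
by move=> /(sat_unfold _ _ Xx (Istop i iI)) [|[]].
Qed.

(** The tail [s] need not be the one witnessing feasibility: what feasibility contributes,
    [k < stop (Phi i)] and [persists], does not depend on the tail. The converse direction needs it,
    since the formula at [k.+1] no longer mentions [x]. *)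
Lemma models_update (k : nat) (I : {set 'I_N}) (x : 'rV[R]_n)
    (s : seq 'rV[R]_n) :
  (forall i, i \in I -> (k <= stop (Phi i))%N) ->
  (forall i, start (Phi i) <= stop (Phi i))%N ->
  feasible X U f Phi k I x ->
  models k (x :: s) (remaining Phi k I) <->
  models k.+1 s (remaining Phi k.+1 (update X Phi k x I)).
Proof.
move=> Istop Phi_interval feas.
have Ustop := feasible_stop Istop Phi_interval feas.
have Xx : X x by case: feas.
rewrite (models_remaining _ Istop) models_remaining; last by move=> i /Ustop[].
split=> h i iI.
  have [ltkb _] := Ustop i iI; move: iI; rewrite in_update // => /andP[iI].
  have := h i iI; have [ki|ik] := ltnP k (start (Phi i)).
    by move=> /(sat_future _ _ _ _ ki) + _; rewrite (maxn_idPr ki).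
  move=> /(sat_unfold _ _ Xx (Istop i iI)) [dis /asboolP //|[_ _ +] _].
  by rewrite (maxn_idPl (leqW ik)).
have [ki|ik] := ltnP k (start (Phi i)).
  apply/sat_future => //; have := h i; rewrite (maxn_idPr ki); apply.
  by rewrite in_update // iI leqNgt ki.
apply/(sat_unfold _ _ Xx (Istop i iI)).
have [dis|ndis] := pselect (discharged X k x (Phi i)); [by left|right].
have iU : i \in update X Phi k x I by rewrite in_update // iI ik; apply/asboolP.
have [ltkb /(_ ik) per] := Ustop i iU.
by split=> //; have := h i iU; rewrite (maxn_idPl (leqW ik)).
Qed.

(** The premise on [U] covers an early stop with [I] empty: the prefix must then still have some
    extension up to the horizon. *)
Lemma monitor_loopP (xs : seq 'rV[R]_n) (k : nat) (I : {set 'I_N})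
    (x : 'rV[R]_n) :
  (forall i, start (Phi i) <= stop (Phi i))%N ->
  (forall i, i \in I -> (k <= stop (Phi i))%N) ->
  (I = finset.set0 -> (k < horizon Phi)%N -> U !=set0) ->
  (k + size xs <= horizon Phi)%N -> X x -> path (step U f) x xs ->
  monitor_loop X U f Phi k I (x :: xs) = PrefixViolated N <->
  ~ exists t, [/\ size t = (horizon Phi - (k + size xs))%N,
      path (step U f) (last x xs) t &
      models k (x :: xs ++ t) (remaining Phi k I)].
Proof.
move=> Phi_interval.
have [l] := ubnP (size xs); elim: l xs k I x => // l IHl xs k I x.
move=> xsl Istop Uneq kT Xx pxs /=.
have [I0|IN0] := eqVneq I finset.set0.
  split=> // -[].
  have [t st pt] : exists2 t, size t = (horizon Phi - (k + size xs))%N &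
      path (step U f) (last x xs) t.
    (* Any extension will do, as the remaining formula is empty; at the horizon it is the empty
       sequence. *)
    have [lt|ge] := ltnP (k + size xs) (horizon Phi).
      by apply/path_total/Uneq => //; lia.
    by exists [::] => //=; lia.
  exists t; split=> //; apply/models_remaining => // i.
  by rewrite I0 finset.in_set0.
have [feas|nfeas] := asboolP (feasible X U f Phi k I x); last first.
  (* An extension [t] of the whole prefix would make [x] feasible through [xs ++ t]. *)
  split=> // _ [t [st pt Mt]]; apply: nfeas; apply/feasibleE; split=> //.
  exists (xs ++ t); split=> //; last by rewrite cat_path pxs.
  by rewrite size_cat st; lia.
case: xs xsl kT pxs => [|y xs] xsl kT pxs.
  (* At the last state read, the feasibility witness is itself the required extension. *)
  have [_ [t [st pt Mt]]] := (feasibleE k I x).1 feas.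
  by split=> [/=|[]]; [case: ifP|exists t; rewrite addn0].
(* The input [u] behind the transition to [y] gives both [X y] and the nonemptiness of [U] for the
   recursive call. *)
have /andP[/asboolP[u Uu yE] pys] := pxs.
rewrite IHl //; first last.
- by rewrite yE; apply: f_stable.
- by rewrite addSnnS.
- by move=> _ _; exists u.
- by move=> i /(feasible_stop Istop Phi_interval feas)[].
rewrite addSnnS; split=> h [t [st pt Mt]]; apply: h; exists t; split=> //.
  exact/(models_update _ Istop Phi_interval feas).
exact/(models_update _ Istop Phi_interval feas).
Qed.

Lemma models_initial (s : seq 'rV[R]_n) :
  models 0 s (remaining Phi 0 (finset.setTfor 'I_N)) <->
  models 0 s (range Phi).
Proof.
rewrite models_remaining //; split=> [h _ [i _ <-]|h i _].
  by have := h i (finset.in_setT i); rewrite max0n; case: (Phi i).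
by rewrite max0n; have := h _ (imageT Phi i); case: (Phi i).
Qed.

End Monitor.

Theorem theorem1 (R : realType) (n m N : nat)
    (X : set 'rV[R]_n) (U : set 'rV[R]_m)
    (f : 'rV[R]_n -> 'rV[R]_m -> 'rV[R]_n)
    (Phi : 'I_N -> subformula 'rV[R]_n)
    (X_bounded : bounded_set X) (U_bounded : bounded_set U)
    (f_stable : forall x u, X x -> U u -> X (f x u))
    (f_continuous : {within X `*` U, continuous (fun p => f p.1 p.2)})
    (N_gt0 : (0 < N)%N)
    (Phi_interval : forall i, (start (Phi i) <= stop (Phi i))%N)
    (Phi_sorted : forall i j : 'I_N,
      (i <= j)%N -> (start (Phi i) <= start (Phi j))%N)
    (Phi_regions : forall i, regions_in X (op (Phi i)))
    (k : nat) (k_le : (k <= horizon Phi)%N)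
    (xs : k.+1.-tuple 'rV[R]_n) (xs_generated : generated X U f xs) :
  monitor X U f Phi xs <-> violated_prefix U f Phi xs.
Proof.
have monitorE : monitor X U f Phi xs <->
    monitor_loop X U f Phi 0 (finset.setTfor 'I_N) xs = PrefixViolated N.
  by rewrite /monitor; case: monitor_loop.
case: (tupleP xs) xs_generated monitorE => x ys gen ->.
have [Xx pys] := generated_path gen.
have lastE : nth 0 [tuple of x :: ys] k = last x ys.
  by rewrite (last_nth 0) (size_tuple ys).
(* The loop starts with all indices and [0 < N], so its index set is nonempty and the premise on [U]
   holds vacuously. *)
rewrite monitor_loopP ?size_tuple //; last first.
  by move=> /setP/(_ (Ordinal N_gt0)); rewrite finset.in_setT finset.in_set0.
rewrite /violated_prefix lastE add0n; split=> h.
  move=> us Uus Mus; apply: h; exists (trajectory f (last x ys) us).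
  have [st pt] := (path_trajectory U f _ _ (trajectory f (last x ys) us)).2
    (ex_intro2 _ _ us Uus erefl).
  by split=> //; apply/models_initial.
move=> [t [st pt /models_initial Mt]].
have [us Uus tE] := (path_trajectory U f _ _ _).1 (conj st pt).
by apply: (h us Uus); rewrite -tE.
Qed.
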